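(* Let $\mathcal{C}$ be a Melnikov formation of finite groups. If $(\Gamma,\Lambda)$ is a $\mathcal{C}$-projective pair, then $\Lambda= M\rtimes\Gamma$ for some closed normal subgroup $M$ of $\Lambda$ (internal semidirect product: $M\cap\Gamma=1$ and $M\Gamma=\Lambda$).
   Context: A Melnikov formation $\mathcal{C}$ is a family of finite groups closed under fiber products (with respect to epimorphisms) and such that for every short exact sequence $1\to A\to B\to C\to 1$ one has $A,C\in\mathcal{C}$ if and only if $B\in\mathcal{C}$. A pro-$\mathcal{C}$ group is a profinite group all of whose finite continuous quotients are in $\mathcal{C}$. All subgroups of profinite groups are closed and all homomorphisms are continuous. Let $\Gamma\le\Lambda$ be pro-$\mathcal{C}$ groups. A $\mathcal{C}$-DEP for $(\Gamma,\Lambda)$ consists of groups $A\le B$ and $G\le H$, all in $\mathcal{C}$, and epimorphisms $\mu\colon\Gamma\to A$, $\alpha\colon G\to A$, $\nu\colon\Lambda\to B$, $\beta\colon H\to B$ such that $\nu|_\Gamma=\mu$ and $\beta|_G=\alpha$. A weak solution is a pair $(\eta,\theta)$ of homomorphisms $\eta\colon\Gamma\to G$, $\theta\colon\Lambda\to H$ (not necessarily surjective) with $\alpha\eta=\mu$, $\beta\theta=\nu$ and $\theta|_\Gamma=\eta$. The pair $(\Gamma,\Lambda)$ is $\mathcal{C}$-projective if every $\mathcal{C}$-DEP for it has a weak solution. *)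

(* Defs.v *)
From HB Require Import structures.
From mathcomp Require Import all_boot all_order all_fingroup all_solvable.
From mathcomp Require Import all_classical topology.

Set Implicit Arguments.
Unset Strict Implicit.
Unset Printing Implicit Defensive.

Local Open Scope group_scope.

HB.mixin Record isTopologicalGroup T of Topological T & monoid.Group T := {
  mulg_continuous : continuous (fun xy : T * T => xy.1 * xy.2) ;
  invg_continuous : continuous (fun x : T => x^-1)
}.

#[short(type="topologicalGroupType")]
HB.structure Definition TopologicalGroup :=
  {T of Topological T & monoid.Group T & isTopologicalGroup T}.

Definition profinite (T : topologicalGroupType) : Prop :=
  [/\ compact [set: T]%classic, hausdorff_space T
    & totally_disconnected [set: T]%classic].

Definition closed_subgroup (T : topologicalGroupType) (D : set T) : Prop :=
  group_closed (mem D) /\ closed D.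

Definition normal_in (T : topologicalGroupType) (D : set T) : Prop :=
  forall x y : T, D x -> D (x ^ y).

Section FiberProduct.

Variables (A B K : finGroupType).
Variables (f : {morphism [set: A]%G >-> K}) (g : {morphism [set: B]%G >-> K}).

Definition fiber_product : {set A * B} := [set ab | f ab.1 == g ab.2].

Lemma fiber_product_group_set : group_set fiber_product.
Proof.
apply/group_setP; split=> [|[a1 b1] [a2 b2]]; rewrite !inE /= ?morph1 //.
by move=> /eqP e1 /eqP e2; rewrite !morphM ?inE // e1 e2.
Qed.

Canonical fiber_product_group := Group fiber_product_group_set.

End FiberProduct.

(* Closure under isomorphism follows from melnikov_exact with a trivial
   third term. *)
Record melnikov_formation (C : finGroupType -> Prop) : Prop := {
  melnikov_fiber_product : forall (A B K : finGroupType)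
      (f : {morphism [set: A]%G >-> K}) (g : {morphism [set: B]%G >-> K}),
    f @* [set: A]%G = [set: K]%G -> g @* [set: B]%G = [set: K]%G ->
    C A -> C B -> C (subg_of (fiber_product_group f g)) ;
  melnikov_exact : forall (A B Q : finGroupType)
      (i : {morphism [set: A]%G >-> B}) (p : {morphism [set: B]%G >-> Q}),
    'injm i -> i @* [set: A]%G = 'ker p -> p @* [set: B]%G = [set: Q]%G ->
    (C A /\ C Q <-> C B)
}.

(* Homomorphisms out of a subgroup D of T are represented by functions on all
   of T whose values outside D are irrelevant. *)
Definition continuous_hom (T : topologicalGroupType) (D : set T)
    (Q : finGroupType) (f : T -> Q) : Prop :=
  {in D &, {morph f : x y / x * y}} /\
  ({within D, continuous (f : T -> discrete_topology Q)})%classic.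

Definition continuous_epi (T : topologicalGroupType) (D : set T)
    (Q : finGroupType) (A : {group Q}) (f : T -> Q) : Prop :=
  continuous_hom D f /\ (f @` D)%classic = [set` A]%classic.

(* For D a closed subgroup of a profinite group, D is itself profinite in the
   subspace topology, and it is pro-C exactly when the following holds. *)
Definition finite_quotients_in (C : finGroupType -> Prop)
    (T : topologicalGroupType) (D : set T) : Prop :=
  forall (Q : finGroupType) (f : T -> Q),
    continuous_epi D [set: Q]%G f -> C Q.

(* The ambient groups B and H are whole types, A and G are subgroups of them;
   mu and alpha take values in B but have image exactly A. *)
Record dep (C : finGroupType -> Prop) (L : topologicalGroupType)
    (Gam : set L) := Dep {
  dep_B : finGroupType ;
  dep_H : finGroupType ;
  dep_A : {group dep_B} ;
  dep_G : {group dep_H} ;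
  dep_BC : C dep_B ;
  dep_HC : C dep_H ;
  dep_AC : C (subg_of dep_A) ;
  dep_GC : C (subg_of dep_G) ;
  dep_mu : L -> dep_B ;
  dep_nu : L -> dep_B ;
  dep_alpha : {morphism dep_G >-> dep_B} ;
  dep_beta : {morphism [set: dep_H]%G >-> dep_B} ;
  dep_mu_epi : continuous_epi Gam dep_A dep_mu ;
  dep_nu_epi : continuous_epi [set: L]%classic [set: dep_B]%G dep_nu ;
  dep_alpha_epi : dep_alpha @* dep_G = dep_A ;
  dep_beta_epi : dep_beta @* [set: dep_H]%G = [set: dep_B]%G ;
  dep_nu_mu : {in Gam, dep_nu =1 dep_mu} ;
  dep_beta_alpha : {in dep_G, dep_beta =1 dep_alpha}
}.

Definition weak_solution (C : finGroupType -> Prop) (L : topologicalGroupType)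
    (Gam : set L) (E : dep C Gam)
    (eta : L -> dep_H E) (theta : L -> dep_H E) : Prop :=
  [/\ continuous_hom Gam eta /\ {in Gam, forall x, eta x \in dep_G E},
      continuous_hom [set: L]%classic theta,
      {in Gam, forall x, dep_alpha E (eta x) = dep_mu E x},
      forall x, dep_beta E (theta x) = dep_nu E x
    & {in Gam, theta =1 eta}].

Definition projective_pair (C : finGroupType -> Prop)
    (L : topologicalGroupType) (Gam : set L) : Prop :=
  forall E : dep C Gam, exists eta theta, @weak_solution C L Gam E eta theta.

(* Main.v *)
Require Import Defs.
From mathcomp Require Import all_boot all_order all_fingroup all_solvable.
From mathcomp Require Import all_classical topology.

(** A closed normal subgroup M of L is a supplement if M * Gam = L.  By
    compactness and Zorn's lemma there is a minimal supplement M; we show that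
    M and Gam meet trivially.  If 1 <> k lies in both, choose a finite quotient
    nu0 of L with nu0 k <> 1, put Q := nu0 Gam and P := Q / nu0 (M `&` Gam), and
    let r : L -> P be the map m g |-> nu0 g modulo nu0 (M `&` Gam).  With B the
    image of (nu0, r), projectivity applied to the projection from the fiber
    product of Q and B over P onto B yields phi : L -> Q which extends nu0 on
    Gam and lifts r.  Then M `&` ker phi is a supplement contained in M and
    missing k, a contradiction. *)

Set Implicit Arguments.
Unset Strict Implicit.
Unset Printing Implicit Defensive.

Local Open Scope group_scope.
Local Open Scope classical_set_scope.

(** * Compact Hausdorff spaces and clopen sets *)

Section CompactSpaces.

Variable T : topologicalType.

(** Directedness makes [F] the base of a proper filter; a cluster point of it lies in the closure of
    every member. *)
Lemma compact_directed_bigcap (F : set (set T)) :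
  compact [set: T] -> F !=set0 ->
  (forall A, F A -> closed A /\ A !=set0) ->
  (forall A B, F A -> F B -> exists2 D, F D & D `<=` A `&` B) ->
  exists p, forall A, F A -> A p.
Proof.
move=> cT F0 Fcl Fdir.
have FF : Filter (filter_from F id) by exact: filter_from_filter.
have PF : ProperFilter (filter_from F id).
  by apply: filter_from_proper => A /Fcl[].
have [p [_ pF]] := cT _ PF filterT.
exists p => A FA; have [Acl _] := Fcl _ FA.
by apply: Acl => U pU; apply: pF => //; exists A.
Qed.

Definition quasi_component (x : T) : set T :=
  [set y | forall D, clopen D -> D x -> D y].

(* In a compact Hausdorff space components and quasi-components agree: if O is
   open and the quasi-component misses the boundary of O, then by compactness
   so does some clopen D, and D `&` O is clopen. *)
Lemma quasi_component_connected (x : T) :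
  hausdorff_space T -> compact [set: T] -> connected (quasi_component x).
Proof.
move=> hT cT; set Q := quasi_component x.
have Qx : Q x by [].
have Qcl : closed Q.
  have -> : Q = \bigcap_(D in [set D | clopen D /\ D x]) D.
    apply/seteqP; split=> y Qy D; first by case; exact: Qy.
    by move=> cD Dx; exact: Qy.
  by apply: closed_bigI => D [[]].
move=> B [b0 Bb0] [U Uo BU] [V Vcl BV].
have Bcl : closed B by rewrite BV; exact: closedI.
(* Normality shrinks this open neighbourhood of [B] to an open [O] whose closure stays inside it, so
   that the closure of [O] meets [Q] only in [B]. *)
have nB : set_nbhs B (U `|` ~` Q).
  apply/set_nbhsP; exists (U `|` ~` Q); split=> //.
    by apply: openU => //; exact: closed_openC.
  by rewrite BU => y [_ Uy]; left.
have [W /set_nbhsP[O [Oo BO OW]] Wsub] := compact_normal hT cT Bcl nB.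
have QO y : Q y -> closure O y -> B y.
  move=> Qy /(closureS OW)/Wsub; rewrite BU => -[] // Uy; split=> //.
have [D cD [Dx DO]] : exists2 D, clopen D & D x /\ D `&` closure O `<=` O.
  apply: contrapT => noD.
  pose E D := D `&` (closure O `&` ~` O).
  have [|A [D [cD Dx] <-]|A A' [D [cD Dx] <-] [D' [cD' Dx'] <-]|p pE] :=
      @compact_directed_bigcap (E @` [set D | clopen D /\ D x]) cT.
  - by exists (E setT), setT => //; split=> //; exact: clopenT.
  - split.
      apply: closedI; first by case: cD.
      by apply: closedI; [exact: closed_closure|exact: open_closedC].
    apply/set0P/eqP => E0; apply: noD; exists D => //; split=> // y [Dy cOy].
    by apply: contrapT => nOy; have : E D y by []; rewrite E0.
  - exists (E (D `&` D')).
      by exists (D `&` D') => //; split=> //; exact: clopenI.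
    by move=> y [[Dy D'y] ?]; split.
  have [_ [cOp nOp]] : E setT p.
    by apply: pE; exists setT => //; split=> //; exact: clopenT.
  apply: nOp; apply: BO; apply: QO => // D cD Dx.
  by have [] : E D p by apply: pE; exists D.
have cDO : clopen (D `&` O).
  split; first by apply: openI => //; case: cD.
  have -> : D `&` O = D `&` closure O.
    apply/seteqP; split=> y [Dy Oy]; split=> //; first exact: subset_closure.
    exact: DO.
  by apply: closedI; [case: cD|exact: closed_closure].
have BQ : B `<=` Q by rewrite BU; exact: subIsetl.
apply/seteqP; split=> // y Qy.
(* Whichever of the clopen sets [D] meet [O] and [D] minus [O] contains [x] contains all of [Q]. In
   the second case this contradicts that [b0] lies in [O]. *)
have [Ox|nOx] := pselect (O x).
  apply: QO => //; apply: subset_closure.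
  by have [] := Qy _ cDO (conj Dx Ox).
have [_ []] : (D `&` ~` (D `&` O)) b0; last first.
  by split; [exact: (BQ _ Bb0 _ cD)|exact: BO].
apply: (BQ _ Bb0); last by split=> // -[].
by apply: clopenI => //; exact: (clopenC set0).
Qed.

(** Points that no clopen set separates share a quasi-component, which is connected and hence a
    single point. *)
Lemma totally_disconnected_zero_dimensional :
  hausdorff_space T -> compact [set: T] -> totally_disconnected [set: T] ->
  zero_dimensional T.
Proof.
move=> hT cT tdT x y /eqP neq_xy; apply: contrapT => noU; apply: neq_xy.
have : connected_component [set: T] x y.
  exists (quasi_component x); last first.
    by move=> D cD Dx; apply: contrapT => nDy; apply: noU; exists D.
  by split=> //; exact: quasi_component_connected.
by rewrite tdT.
Qed.

End CompactSpaces.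

Lemma continuous_discreteP (T : topologicalType) (D : set T) (Q : choiceType)
    (f : T -> Q) :
  {within D, continuous (f : T -> discrete_topology Q)} <->
  (forall x, D x -> \forall y \near x, D y -> f y = f x).
Proof.
split=> [/subspace_continuousP cf x Dx|cf].
  exact: (cf x Dx [set f x]).
apply/subspace_continuousP => x Dx A /= Afx.
have {}Afx : A (f x) by exact: (nbhs_singleton Afx).
by apply: filterS (cf x Dx) => y /[apply] fyx; rewrite -fyx in Afx.
Qed.

(** * Closed subgroups and homomorphisms to finite groups *)

Section TopologicalGroups.

Variable L : topologicalGroupType.
Implicit Types (D W : set L) (x y g : L).

Lemma closed_subgroup1 D : closed_subgroup D -> D 1.
Proof. by case=> -[D1 _] _; rewrite -in_setE. Qed.

Lemma closed_subgroupM D x y : closed_subgroup D -> D x -> D y -> D (x * y).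
Proof.
case=> /group_closedM DM _ /mem_set Dx /mem_set Dy; apply: set_mem.
exact: DM.
Qed.

Lemma closed_subgroupV D x : closed_subgroup D -> D x -> D x^-1.
Proof.
by case=> /group_closedV DV _ /mem_set Dx; apply: set_mem; exact: DV.
Qed.

Lemma closed_subgroupP D :
  D 1 -> (forall x y, D x -> D y -> D (x * y^-1)) -> closed D ->
  closed_subgroup D.
Proof.
move=> D1 DB Dcl; split=> //; split=> [|x y]; rewrite !in_setE //.
exact: DB.
Qed.

Lemma closed_subgroupI D D' : closed_subgroup D -> closed_subgroup D' ->
  closed_subgroup (D `&` D').
Proof.
move=> cD cD'; apply: closed_subgroupP.
- by split; exact: closed_subgroup1.
- move=> x y [Dx D'x] [Dy D'y]; split;
  by apply: closed_subgroupM => //; exact: closed_subgroupV.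
- by apply: closedI; [case: cD|case: cD'].
Qed.

Lemma closed_subgroupT : closed_subgroup [set: L].
Proof. by apply: closed_subgroupP => //; exact: closedT. Qed.

Lemma mulgl_continuous x : continuous (fun y => x * y).
Proof.
move=> y; apply: (@cvg_comp _ _ _ (fun z => (x, z)) _ _ _ _ _
  (@mulg_continuous L (x, y))).
by apply: cvg_pair; [exact: cvg_cst|exact: cvg_id].
Qed.

Lemma mulgr_continuous x : continuous (fun y => y * x).
Proof.
move=> y; apply: (@cvg_comp _ _ _ (fun z => (z, x)) _ _ _ _ _
  (@mulg_continuous L (y, x))).
by apply: cvg_pair; [exact: cvg_id|exact: cvg_cst].
Qed.

Lemma near_mulgl x (P : set L) : (\forall z \near 1, P (x * z)) ->
  \forall y \near x, P y.
Proof.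
move=> P1; have : nbhs (x^-1 * x) [set z | P (x * z)] by rewrite mulVg.
move/(@mulgl_continuous x^-1 x) => {}P1.
have {P1} : \forall y \near x, P (x * (x^-1 * y)) by [].
by apply: filterS => y; rewrite mulVKg.
Qed.

Lemma hom1 D (Q : finGroupType) (f : L -> Q) : closed_subgroup D ->
  continuous_hom D f -> f 1 = 1.
Proof.
move=> cD [fM _]; apply: (mulgI (f 1)).
by rewrite -fM ?in_setE ?mulg1 //; exact: closed_subgroup1.
Qed.

Lemma homM D (Q : finGroupType) (f : L -> Q) x y : continuous_hom D f ->
  D x -> D y -> f (x * y) = f x * f y.
Proof. by case=> fM _ Dx Dy; rewrite fM ?in_setE. Qed.

Lemma homV D (Q : finGroupType) (f : L -> Q) x : closed_subgroup D ->
  continuous_hom D f -> D x -> f x^-1 = (f x)^-1.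
Proof.
move=> cD hf Dx; apply: (mulgI (f x)).
by rewrite -(homM hf) ?mulgV ?(hom1 cD hf) //; exact: closed_subgroupV.
Qed.

Lemma hom_near1 (Q : finGroupType) (f : L -> Q) :
  {morph f : x y / x * y} -> (\forall x \near 1, f x = 1) ->
  continuous_hom [set: L] f.
Proof.
move=> fM f1; split=> [x y _ _|]; first exact: fM.
apply/continuous_discreteP => x _; apply: near_mulgl.
by apply: filterS f1 => z fz _; rewrite fM fz mulg1.
Qed.

Lemma sub_continuous_hom D D' (Q : finGroupType) (f : L -> Q) :
  D `<=` D' -> continuous_hom D' f -> continuous_hom D f.
Proof.
move=> sD [fM /continuous_discreteP cf]; split=> [x y|].
  by rewrite !in_setE => /sD Dx /sD Dy; apply: fM; rewrite in_setE.
apply/continuous_discreteP => x /sD D'x.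
by apply: filterS (cf x D'x) => y + /sD; apply.
Qed.

Lemma hom_preimage_closed D (Q : finGroupType) (f : L -> Q) (A : set Q) :
  closed D -> continuous_hom D f -> closed (D `&` f @^-1` A).
Proof.
move=> Dcl [_ /continuous_discreteP cf] x clx.
have Dx : D x by apply: Dcl; apply: closureS clx; exact: subIsetl.
by have [y [[Dy Ay] /(_ Dy) fyx]] := clx _ (cf x Dx); split; rewrite //= -fyx.
Qed.

Lemma hom_image_group D (Q : finGroupType) (f : L -> Q) :
  closed_subgroup D -> continuous_hom D f ->
  exists A : {group Q}, f @` D = [set` A].
Proof.
move=> cD hf; pose A := [set q | `[< (f @` D) q >]]%SET.
have memA q : q \in A <-> (f @` D) q by rewrite inE asboolE.
have gA : group_set A.
  apply/group_setP; split=> [|a b].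
    by apply/memA; exists 1; [exact: closed_subgroup1|exact: hom1 cD hf].
  move=> /memA[x Dx <-] /memA[y Dy <-]; apply/memA.
  by exists (x * y); [exact: closed_subgroupM|exact: homM hf Dx Dy].
by exists (Group gA); apply/seteqP; split=> q /memA.
Qed.

(** Corestriction of [f] to its image, turned into a whole group type because [finite_quotients_in]
    speaks only of such targets. *)
Lemma hom_image_epi D (Q : finGroupType) (f : L -> Q) (A : {group Q}) :
  continuous_hom D f -> f @` D = [set` A] ->
  continuous_epi D [set: subg_of A]%G (fun x => subg A (f x)).
Proof.
move=> hf fA; have fAx x : D x -> f x \in A.
  by move=> Dx; have : [set` A] (f x) by rewrite -fA; exists x.
split; first split.
- move=> x y; rewrite !in_setE => Dx Dy; apply: val_inj.
  by rewrite /= !subgK ?groupM ?(homM hf) ?fAx // groupM ?fAx.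
- apply/continuous_discreteP => x Dx.
  by case: hf => _ /continuous_discreteP/(_ x Dx); apply: filterS => y + /[dup]
    => /[apply] ->.
apply/seteqP; split=> a _ /=; first by rewrite inE.
have [x Dx fx] : (f @` D) (sgval a) by rewrite fA /=; exact: subgP.
by exists x => //; rewrite fx sgvalK.
Qed.

Lemma hom_image_in C D (Q : finGroupType) (f : L -> Q) (A : {group Q}) :
  finite_quotients_in C D -> continuous_hom D f -> f @` D = [set` A] ->
  C (subg_of A).
Proof. by move=> qC hf fA; exact: qC (hom_image_epi hf fA). Qed.

(** The target [F] need not be in [C], but the image of [f] is; [e] is the inclusion of that
    image. *)
Lemma hom_factor C D (F : finGroupType) (f : L -> F) : closed_subgroup D ->
  finite_quotients_in C D -> continuous_hom D f ->
  exists (Q : finGroupType) (q : L -> Q) (e : Q -> F),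
    [/\ C Q, continuous_epi D [set: Q]%G q, {morph e : x y / x * y},
        injective e & forall x, D x -> e (q x) = f x].
Proof.
move=> cD qC hf; have [A fA] := hom_image_group cD hf.
exists (subg_of A), (fun x => subg A (f x)), sgval; split=> //.
- exact: hom_image_in qC hf fA.
- exact: hom_image_epi hf fA.
- exact: val_inj.
move=> x Dx; rewrite subgK //.
by have : [set` A] (f x) by rewrite -fA; exists x.
Qed.

(** * Clopen sets and separation by finite quotients *)

Definition translate x W : set L := [set y | W (x^-1 * y)].

Lemma translate1 W : translate 1 W = W.
Proof. by apply/seteqP; split=> y; rewrite /translate /= invg1 mul1g. Qed.

Lemma translateM x y W : translate x (translate y W) = translate (x * y) W.
Proof. by apply/seteqP; split=> z; rewrite /translate /= invMg mulgA. Qed.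

Lemma clopen_translate x W : clopen W -> clopen (translate x W).
Proof. by move=> cW; apply: preimage_clopen => //; exact: mulgl_continuous. Qed.

(** Near each pair ([y], 1), continuity of division keeps [x^-1 * z] on the same side of [W] as [z];
    compactness makes the neighbourhood of 1 uniform in [y]. *)
Lemma translate_near1 W : compact [set: L] -> clopen W ->
  \forall x \near 1, translate x W = W.
Proof.
move=> /compact_near_coveringP cL cW.
have near_div (V : set L) y : open V -> V y ->
    \forall z \near y & x \near 1, V z /\ V (x^-1 * z).
  move=> Vo Vy; have Vn : nbhs (1^-1 * y) V.
    by rewrite invg1 mul1g; exact: open_nbhs_nbhs.
  have cvg_div : (fun zx : L * L => zx.2^-1 * zx.1) @ (y, 1 : L) --> 1^-1 * y.
    apply: (@cvg_comp _ _ _ (fun zx : L * L => (zx.2^-1, zx.1)) _ _ _ _ _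
      (@mulg_continuous L (1^-1, y))).
    apply: cvg_pair; last exact: cvg_fst.
    by apply: cvg_comp; [exact: cvg_snd|exact: invg_continuous].
  apply: filterI; last exact: cvg_div Vn.
  by apply: (@cvg_fst _ _ (nbhs y) (nbhs (1 : L))); exact: open_nbhs_nbhs.
have : \forall x \near 1, [set: L] `<=` (fun y => W (x^-1 * y) <-> W y).
  apply: cL => y _; have [Wy|nWy] := pselect (W y).
    by apply: filterS (near_div W y cW.1 Wy) => -[z x] /= [].
  apply: filterS (near_div (~` W) y (closed_openC cW.2) nWy).
  by move=> -[z x] /= [].
by apply: filterS => x stW; apply/seteqP; split=> y /(stW y I).
Qed.

(** The translate is a locally constant function of [x], so on a compact group it takes finitely
    many values. *)
Lemma finite_translates W : compact [set: L] -> clopen W ->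
  exists s : seq (set L), forall x, translate x W \in s.
Proof.
move=> /[dup] cL /compact_near_coveringP ncL cW.
(* The filter of all sufficiently large lists: compactness in its near-covering form then merges the
   local lists into one. *)
pose F := filter_from [set: seq (set L)]
  (fun s => [set s' : seq (set L) | {subset s <= s'}]).
have FF : Filter F.
  apply: filter_from_filter => [|s t _ _]; first by exists [::].
  exists (s ++ t) => // r str.
  by split=> z zs; apply: str; rewrite mem_cat zs ?orbT.
have : \forall s \near F, [set: L] `<=` (fun x => translate x W \in s).
  apply: ncL => x _.
  exists ([set y | translate y W = translate x W],
          [set s : seq (set L) | {subset [:: translate x W] <= s}]) => /=.
    split; last by exists [:: translate x W].
    apply: near_mulgl; apply: filterS (translate_near1 cL cW) => z /= Wz.
    by rewrite -translateM Wz.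
  by move=> [y s] /= [-> xs]; apply: xs; rewrite inE.
by move=> [s _ sF]; exists s => x; exact: (sF s).
Qed.

(* The finite quotient is the image of the left translation action on the
   finitely many translates of W; inverting x makes it a morphism, products of
   permutations being composed from left to right. *)
Lemma clopen_finite_quotient W : compact [set: L] -> clopen W -> W 1 ->
  exists (F : finGroupType) (f : L -> F),
    continuous_hom [set: L] f /\ forall x, f x = 1 -> W x.
Proof.
move=> cL cW W1; have [s sW] := finite_translates cL cW.
pose r := [seq Y <- s | `[< exists x, Y = translate x W >]].
have memr Y : Y \in r <-> exists x, Y = translate x W.
  rewrite mem_filter; split=> [/andP[/asboolP]//|[x ->]].
  by rewrite sW andbT; apply/asboolP; exists x.
have act_subproof x (Y : seq_sub r) : translate x^-1 (val Y) \in r.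
  have /memr[y ->] := valP Y.
  by apply/memr; exists (x^-1 * y); rewrite translateM.
pose act x (Y : seq_sub r) : seq_sub r := SeqSub (act_subproof x Y).
have actK x : cancel (act x) (act x^-1).
  by move=> Y; apply: val_inj; rewrite /= translateM invgK mulgV translate1.
pose f x := perm (can_inj (actK x)).
exists {perm seq_sub r}, f; split.
  apply: hom_near1 => [x y|].
    apply/permP => Y; rewrite permM !permE; apply: val_inj.
    by rewrite /= translateM invMg.
  have : \forall x \near 1, forall Y : seq_sub r, translate x (val Y) = val Y.
    apply: filter_forall => Y; apply: translate_near1 => //.
    by have /memr[y ->] := valP Y; exact: clopen_translate.
  apply: filterS => x xY; apply/permP => Y; rewrite permE perm1.
  by apply: val_inj; rewrite /= -{1}(xY Y) translateM mulVg translate1.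
(* Since [f x] fixes the point [W], translation by [x^-1] preserves [W]; evaluating at 1 gives
   [W x]. *)
move=> x fx1; have rW : W \in r by apply/memr; exists 1; rewrite translate1.
have /(congr1 val) /= : act x (SeqSub rW) = SeqSub rW.
  by rewrite -[LHS](permE (can_inj (actK x))) -/(f x) fx1 perm1.
by move=> xW; rewrite -[x]mulg1 -[x in x * _]invgK; rewrite -xW in W1.
Qed.

Lemma profinite_separated x : profinite L -> x <> 1 ->
  exists (F : finGroupType) (f : L -> F),
    continuous_hom [set: L] f /\ f x <> 1.
Proof.
move=> [cL hL tdL] /eqP; rewrite eq_sym => nx1.
have [W [cW W1 nWx]] := totally_disconnected_zero_dimensional hL cL tdL nx1.
have [F [f [hf fW]]] := clopen_finite_quotient cL cW W1.
by exists F, f; split=> // /fW.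
Qed.

End TopologicalGroups.
Arguments closed_subgroupT {L}.

(** * Lifting through fiber products by projectivity *)

Section ProjectivePairs.

Variables (C : finGroupType -> Prop) (L : topologicalGroupType) (Gam : set L).
Hypothesis melC : melnikov_formation C.
Hypothesis cGam : closed_subgroup Gam.
Hypothesis qGam : finite_quotients_in C Gam.
Hypothesis projC : projective_pair C Gam.

(* The double embedding problem solved here is the projection of the fiber
   product of Q and B over P to B, with G the image of Gam under (q, nu). *)
Lemma projective_fiber_lift (Q B P : finGroupType)
    (f : {morphism [set: Q]%G >-> P}) (g : {morphism [set: B]%G >-> P})
    (q : L -> Q) (nu : L -> B) :
  C Q -> C B ->
  f @* [set: Q]%G = [set: P]%G -> g @* [set: B]%G = [set: P]%G ->
  continuous_hom Gam q -> continuous_epi [set: L] [set: B]%G nu ->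
  (forall x, Gam x -> f (q x) = g (nu x)) ->
  (forall x y, Gam x -> Gam y -> nu x = nu y -> q x = q y) ->
  exists phi : L -> Q,
    [/\ continuous_hom [set: L] phi, forall x, Gam x -> phi x = q x
      & forall x, f (phi x) = g (nu x)].
Proof.
move=> CQ CB fP gP hq nu_epi fq_gnu nu_q.
have hnu : continuous_hom Gam nu by apply: sub_continuous_hom (nu_epi.1).
pose H := fiber_product_group f g.
(* Outside [Gam] the pair may leave [H], and [subg] then returns 1; [psi] is used only on [Gam]. *)
pose psi x := subg H (q x, nu x).
have psiK x : Gam x -> sgval (psi x) = (q x, nu x).
  by move=> Gx; rewrite /psi subgK // inE /= fq_gnu.
have hpsi : continuous_hom Gam psi.
  split.
    move=> x y; rewrite !in_setE => Gx Gy; apply: val_inj.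
    rewrite /= !psiK //; last exact: closed_subgroupM.
    by rewrite (homM hq) // (homM hnu).
  apply/continuous_discreteP => x Gx.
  case: hq => _ /continuous_discreteP/(_ x Gx) q_near.
  case: hnu => _ /continuous_discreteP/(_ x Gx) nu_near.
  apply: filterS (filterI q_near nu_near) => y [qy nuy] Gy.
  by rewrite /psi qy // nuy.
have [A nuA] := hom_image_group cGam hnu.
have [G psiG] := hom_image_group cGam hpsi.
pose bet (h : subg_of H) := (sgval h).2.
have betM : {in [set: subg_of H]%G &, {morph bet : x y / x * y}} by [].
pose beta := Morphism betM.
pose alpha := [morphism of restrm (finset.subsetT G) beta].
have memG h : h \in G -> exists2 x, Gam x & psi x = h.
  by move=> hG; have : [set` G] h by []; rewrite -psiG.
have psi_in x : Gam x -> psi x \in G.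
  by move=> Gx; have : [set` G] (psi x) by rewrite -psiG; exists x.
have memA b : b \in A -> exists2 x, Gam x & nu x = b.
  by move=> bA; have : [set` A] b by []; rewrite -nuA.
have nu_in x : Gam x -> nu x \in A.
  by move=> Gx; have : [set` A] (nu x) by rewrite -nuA; exists x.
have alphaA : alpha @* G = A.
  rewrite morphim_restrm finset.setIid; apply/setP => b.
  apply/morphimP/idP => [[h _ hG ->]|/memA[x Gx <-]].
    by have [x Gx <-] := memG h hG; rewrite /= /bet psiK //; exact: nu_in.
  by exists (psi x); rewrite ?inE ?psi_in //= /bet psiK.
have betaB : beta @* [set: subg_of H]%G = [set: B]%G.
  apply/setP => b; rewrite !inE; apply/morphimP.
  have : g b \in f @* [set: Q]%G by rewrite fP inE.
  case/morphimP=> a _ _ gb.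
  exists (subg H (a, b)); rewrite ?inE //= /bet subgK // inE /=.
  exact/eqP.
have CH : C (subg_of H) := melnikov_fiber_product melC fP gP CQ CB.
have CA : C (subg_of A) := hom_image_in qGam hnu nuA.
have CG : C (subg_of G) := hom_image_in qGam hpsi psiG.
(* Both [dep_mu] and [dep_nu] are [nu], and [alpha] is a restriction of [beta], so the
   compatibilities hold by reflexivity. *)
have [eta [theta []]] := projC (@Dep C L Gam B (subg_of H) A G CB CH CA CG
  nu nu alpha beta (conj hnu nuA) nu_epi alphaA betaB (fun=> fun=> erefl)
  (fun=> fun=> erefl)).
rewrite /= => -[_ etaG] htheta _ beta_theta theta_eta.
exists (fun x => (sgval (theta x)).1); split.
- split=> [x y _ _|]; first by rewrite (homM htheta).
  apply/continuous_discreteP => x _.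
  case: htheta => _ /continuous_discreteP/(_ x I).
  by apply: filterS => y /[apply] ->.
- move=> x Gx; have memx : x \in Gam by rewrite in_setE.
  (* Only [eta x = psi y] for some [y] in [Gam] is known. Its second component gives [nu y = nu x],
     and then [q y = q x] because [nu] determines [q] on [Gam]. *)
  have [y Gy psiy] := memG _ (etaG x memx).
  have := beta_theta x; rewrite /bet theta_eta // -psiy psiK //= => nu_yx.
  exact: nu_q.
move=> x; rewrite -beta_theta.
by have := subgP (theta x); rewrite inE => /eqP.
Qed.

(** * Normal supplements of [Gam] and their minimality *)

Hypothesis profL : profinite L.
Hypothesis qL : finite_quotients_in C [set: L].

(** Writing the factor in [Gam] as [m^-1 * x] exhibits the admissible [m], for fixed [x], as a
    preimage of the closed set [Gam]. *)
Definition supplement (M : set L) : Prop :=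
  [/\ closed_subgroup M, normal_in M
    & forall x, exists2 m, M m & Gam (m^-1 * x)].

(** The value does not depend on the factorization because [f] after [q] kills the intersection of
    [M] and [Gam]; normality of [M] makes [r] multiplicative, and compactness makes it
    continuous. *)
Lemma supplement_hom (Q P : finGroupType) (f : {morphism [set: Q]%G >-> P})
    (q : L -> Q) (M : set L) :
  supplement M -> continuous_hom Gam q ->
  (forall x, M x -> Gam x -> f (q x) = 1) ->
  exists2 r : L -> P, continuous_hom [set: L] r &
    forall m g, M m -> Gam g -> r (m * g) = f (q g).
Proof.
move=> [cM nM suppM] hq fq1.
have /choice[mu muP] : forall x, exists m, M m /\ Gam (m^-1 * x).
  by move=> x; have [m] := suppM x; exists m.
pose r x := f (q ((mu x)^-1 * x)).
have rE m g : M m -> Gam g -> r (m * g) = f (q g).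
  move=> Mm Gg; rewrite /r; have [] := muP (m * g).
  set h := _^-1 * (m * g) => Mmu Gh.
  (* The two [Gam]-parts [h] and [g] of the same element differ by an element of both [M] and
     [Gam]. *)
  have Ggh : Gam (h * g^-1).
    by apply: closed_subgroupM => //; exact: closed_subgroupV.
  rewrite -[h](mulgKV g) (homM hq) // morphM ?inE // fq1 ?mul1g //.
  rewrite /h -!mulgA mulgV mulg1.
  by apply: closed_subgroupM => //; exact: closed_subgroupV.
exists r => //; split=> [x y _ _|].
  have [Mx Gx] := muP x; have [My Gy] := muP y.
  (* Conjugating [mu y] past [x] collects the [M]-parts on the left. *)
  have -> : x * y = (mu y) ^ x^-1 * mu x * (((mu x)^-1 * x) * ((mu y)^-1 * y)).
    by rewrite /conjg invgK !mulgA mulgK mulgKV mulgK.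
  rewrite rE; last exact: closed_subgroupM.
    by rewrite (homM hq) // morphM ?inE.
  by apply: closed_subgroupM => //; exact: nM.
apply/continuous_discreteP => x _.
have [cL hL _] := profL.
have closed_compact (A : set L) : closed A -> compact A.
  by move=> Acl; exact: subclosed_compact Acl cL _.
pose A := [set a | f a <> r x].
(* This set is the image under multiplication of a compact product, hence closed; its complement is
   a neighbourhood of [x] on which [r] is constant. *)
have ncl : closed [set y | r y <> r x].
  have -> : [set y | r y <> r x] =
      (fun zt : L * L => zt.1 * zt.2) @` (M `*` (Gam `&` q @^-1` A)).
    apply/seteqP; split=> y /=.
      move=> ry; have [My Gy] := muP y.
      by exists (mu y, (mu y)^-1 * y); rewrite /= ?mulVKg.
    by move=> [[m g] [/= Mm [Gg Ag]] <-]; rewrite rE.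
  apply: compact_closed => //; apply: continuous_compact.
    by apply: continuous_subspaceT; exact: mulg_continuous.
  apply: compact_setX; apply: closed_compact; first by case: cM.
  by apply: hom_preimage_closed => //; case: cGam.
have : nbhs x (~` [set y | r y <> r x]).
  by apply: open_nbhs_nbhs; split; [exact: closed_openC|move=> /(_ erefl)].
by apply: filterS => y nry _; exact: contrapT.
Qed.

Lemma supplement_shrink (M : set L) (k : L) :
  supplement M -> M k -> Gam k -> k <> 1 ->
  exists M', [/\ supplement M', M' `<=` M & ~ M' k].
Proof.
move=> /[dup] sM [cM nM suppM] Mk Gk k1.
have [F [nu0 [hnu0 nu0k]]] := profinite_separated profL k1.
have hnu0G : continuous_hom Gam nu0 by exact: sub_continuous_hom hnu0.
have [Q [q [e [CQ [hq qQ] _ e_inj eqE]]]] := hom_factor cGam qGam hnu0G.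
have qGamE a : exists2 x, Gam x & q x = a.
  by have : (q @` Gam) a by rewrite qQ /= inE.
have hqM : continuous_hom (M `&` Gam) q.
  by apply: sub_continuous_hom hq; exact: subIsetr.
have [K qK] := hom_image_group (closed_subgroupI cM cGam) hqM.
have memK a : a \in K -> exists2 x, M x /\ Gam x & q x = a.
  by move=> aK; have : [set` K] a by []; rewrite -qK.
have q_in x : M x -> Gam x -> q x \in K.
  by move=> Mx Gx; have : [set` K] (q x) by rewrite -qK; exists x.
have nK : [set: Q]%G \subset 'N(K).
  apply/fintype.subsetP => a _; have [x Gx <-] := qGamE a.
  rewrite inE; apply/fintype.subsetP => _ /imsetP[b /memK[y [My Gy] <-] ->].
  have GxV := closed_subgroupV cGam Gx.
  have Gxy := closed_subgroupM cGam Gy Gx.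
  rewrite /conjg -(homV cGam hq) // -!(homM hq) //.
  by apply: q_in; [exact: nM|exact: closed_subgroupM].
pose f := [morphism of restrm nK (coset K)].
have fP : f @* [set: Q]%G = [set: coset_of K]%G.
  rewrite morphim_restrm finset.setIid; apply/setP => c; rewrite [RHS]inE.
  by case: (cosetP c) => a Na ->; rewrite mem_morphim ?finset.in_setT.
have [r hr rE] := @supplement_hom _ _ f q M sM hq
  (fun x Mx Gx => coset_id (q_in x Mx Gx)).
have rGam x : Gam x -> r x = f (q x).
  by move=> Gx; rewrite -[x in LHS]mul1g rE //; exact: closed_subgroup1.
(* The component [nu0] makes the pair determine [q] on [Gam]; the component [r] supplies the map [g]
   to the quotient by [K]. *)
have hnu : continuous_hom [set: L] (fun x => (nu0 x, r x)).
  split=> [x y _ _|]; first by rewrite (homM hnu0) // (homM hr).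
  apply/continuous_discreteP => x _.
  case: hnu0 => _ /continuous_discreteP/(_ x I) nu0_near.
  case: hr => _ /continuous_discreteP/(_ x I) r_near.
  apply: filterS (filterI nu0_near r_near) => y [nu0y ry] _.
  by rewrite nu0y ?ry.
have [B [nu [e' [CB nu_epi e'M _ e'E]]]] :=
  hom_factor closed_subgroupT qL hnu.
have gM : {in [set: B]%G &, {morph (fun b => (e' b).2) : x y / x * y}}.
  by move=> x y _ _; rewrite e'M.
pose g := Morphism gM.
have gnu x : g (nu x) = r x by rewrite /= e'E.
have gP : g @* [set: B]%G = [set: coset_of K]%G.
  apply/setP => c; have : c \in f @* [set: Q]%G by rewrite fP inE.
  rewrite inE => /morphimP[a _ _ ->]; have [x Gx <-] := qGamE a.
  by rewrite -rGam // -gnu; apply: mem_morphim; rewrite inE.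
have [x Gx|x y Gx Gy nu_xy|phi [hphi phiG phi_r]] :=
    projective_fiber_lift CQ CB fP gP hq nu_epi.
- by rewrite gnu rGam.
- apply: e_inj; rewrite !eqE //.
  by have := congr1 e' nu_xy; rewrite !e'E // => -[].
have phi1 := hom1 closed_subgroupT hphi.
exists (M `&` [set x | phi x = 1]); split; first split.
- apply: closed_subgroupI => //; apply: closed_subgroupP => //=.
    move=> x y phix phiy.
    by rewrite (homM hphi) // (homV closed_subgroupT hphi) // phix phiy mulgV.
  rewrite -[X in closed X]setTI.
  exact: (hom_preimage_closed (A := [set 1]) closedT hphi).
- move=> x y [Mx /= phix]; split; first exact: nM.
  by rewrite /conjg /= !(homM hphi) // (homV closed_subgroupT hphi) // phix
    mul1g mulVg.
- move=> x; have [m Mm Gmx] := suppM x.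
  (* Thus [phi m] lies in [K] and equals [q j], that is [phi j], for some [j] in both [M] and [Gam].
     Replacing [m] by [m * j^-1] puts it in the kernel of [phi] and changes the other factor only
     within [Gam]. *)
  have : f (phi m) = 1.
    rewrite phi_r gnu -[m]mulg1 rE //; last exact: closed_subgroup1.
    by rewrite (hom1 cGam hq) morph1.
  move=> /coset_idr; rewrite (fintype.subsetP nK) ?inE //.
  move=> /(_ isT)/memK[j [Mj Gj] qj].
  exists (m * j^-1); last first.
    by rewrite invMg invgK -mulgA; exact: closed_subgroupM.
  split; first by apply: closed_subgroupM => //; exact: closed_subgroupV.
  rewrite /= (homM hphi) // (homV closed_subgroupT hphi) //.
  by rewrite (phiG j) // qj mulgV.
- exact: subIsetl.
(* On [Gam], [phi] agrees with [q], which [e] carries to [nu0]; so [phi k = 1] would force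
   [nu0 k = 1]. *)
move=> [_ /= phik]; apply: nu0k.
rewrite -eqE // -phiG // phik -(hom1 cGam hq) eqE ?(hom1 cGam hnu0G) //.
exact: closed_subgroup1.
Qed.

(** Zorn's lemma is applied to complements, turning unions of chains into intersections of
    supplements. For each [x] the admissible [m] in the members of a chain form nested nonempty
    closed sets, so compactness gives a common one. *)
Lemma minimal_supplement :
  exists M, supplement M /\ forall M', supplement M' -> M' `<=` M -> M' = M.
Proof.
have [cL hL _] := profL.
have [F Fsupp Ftot|N [sN maxN]] :=
    @Zorn_bigcup L [set N | supplement (~` N)]; last first.
  exists (~` N); split=> // M' sM' M'N; apply: contrapT => neq.
  apply: (maxN (~` M')); last by rewrite /= setCK.
  split; first by rewrite -[N]setCK; exact: subsetC.
  move=> sub; apply: neq; apply/seteqP; split=> //.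
  by rewrite -[M']setCK; exact: subsetC.
rewrite /= setC_bigcup; split.
- apply: closed_subgroupP.
  + by move=> N /Fsupp[cN _ _]; exact: closed_subgroup1.
  + move=> x y Mx My N FN; have [cN _ _] := Fsupp _ FN.
    apply: closed_subgroupM (Mx N FN) _ => //.
    by apply: closed_subgroupV (My N FN).
  + by apply: closed_bigI => N /Fsupp[[]].
- by move=> x y Mx N FN; have [_ nN _] := Fsupp _ FN; apply: nN; exact: Mx.
(* The empty chain has intersection [L], where [m = x] works; the compactness argument needs a
   nonempty family. *)
move=> x; have [F0|/set0P nF] := eqVneq F set0.
  by exists x; [rewrite F0|rewrite mulVg; exact: closed_subgroup1].
pose E N := ~` N `&` [set m | Gam (m^-1 * x)].
have Ecl N : F N -> closed (E N).
  move=> /Fsupp[[_ Ncl] _ _]; apply: closedI => //.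
  apply: (@preimage_closed _ _ (fun m : L => m^-1 * x) Gam);
    last by case: cGam.
  move=> m _; apply: (@continuous_comp _ _ _ (fun m : L => m^-1)
    (fun m => m * x)).
    exact: invg_continuous.
  exact: mulgr_continuous.
have [||A B [N FN <-] [N' FN' <-]|m mE] :=
    @compact_directed_bigcap L (E @` F) cL.
- by have [N FN] := nF; exists (E N), N.
- move=> _ [N FN <-]; split; first exact: Ecl.
  by have [_ _ /(_ x)[m Nm Gm]] := Fsupp _ FN; exists m.
- have [sub|sub] := Ftot _ _ FN FN'.
    exists (E N'); first by exists N'.
    by move=> m [nm Gm]; do 2?split=> //; move/sub.
  exists (E N); first by exists N.
  by move=> m [nm Gm]; do 2?split=> //; move/sub.
exists m; first by move=> N FN; have [] : E N m by apply: mE; exists N.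
by have [N FN] := nF; have [] : E N m by apply: mE; exists N.
Qed.

End ProjectivePairs.

Theorem corollary2p17 (C : finGroupType -> Prop) (L : topologicalGroupType)
    (Gam : set L) :
  melnikov_formation C ->
  profinite L -> closed_subgroup Gam ->
  finite_quotients_in C [set: L]%classic -> finite_quotients_in C Gam ->
  projective_pair C Gam ->
  exists M : set L,
    [/\ closed_subgroup M, normal_in M,
        (M `&` Gam)%classic = [set 1]%classic
      & [set x * y | x in M & y in Gam]%classic = [set: L]%classic].
Proof.
move=> melC profL cGam qL qGam projC.
have [M [/[dup] sM [cM nM suppM] minM]] := minimal_supplement cGam profL.
exists M; split=> //; apply/seteqP; split=> // x.
- move=> [Mx Gx]; apply: contrapT => x1.
  have [M' [sM' M'M]] :=
    supplement_shrink melC cGam qGam projC profL qL sM Mx Gx x1.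
  by rewrite (minM M').
- by move=> ->; split; exact: closed_subgroup1.
move=> _; have [m Mm Gm] := suppM x.
by exists m => //; exists (m^-1 * x); rewrite ?mulVKg.
Qed.
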